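(* Let $A, B, C, D$ be four non-overlapping unit balls in $\mathbb{R}^3$, and suppose that $\{A,B,C,D\}$ pins two lines $\sigma_1$ and $\sigma_2$ that realize the geometric permutations $ABCD$ and $ACDB$, respectively. Then neither $\sigma_1$ nor $\sigma_2$ is pinned by a proper subset of $\{A,B,C,D\}$.
   Context: A unit ball is a closed ball of radius one. A family of balls is non-overlapping if its members have pairwise disjoint interiors (they may touch). A line transversal to a non-overlapping family is a line that intersects every member of the family and that is not tangent to two touching members at their common point of contact (equivalently, common points of contact are removed from the sets, which makes them pairwise disjoint). A line transversal realizes the geometric permutation $X_1X_2\ldots X_n$ if, for one of its two orientations, it meets the balls in the order $X_1, X_2, \ldots, X_n$ (with direction $\vec v$, it meets $X$ before $Y$ if and only if $\vec{v}\cdot(y-x)>0$, where $x,y$ are the centers). A family $\mathcal{F}$ pins a line $\ell$ if $\ell$ is a line transversal to $\mathcal{F}$ and no sufficiently small perturbation of $\ell$ other than $\ell$ itself is a line transversal to $\mathcal{F}$; equivalently, $\ell$ is an isolated point of the space of line transversals to $\mathcal{F}$, with the natural topology on the space of lines. *)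

(* Defs.v *)
From HB Require Import structures.
From mathcomp Require Import all_boot all_order all_algebra.
From mathcomp Require Import all_classical all_reals all_analysis.

Set Implicit Arguments.
Unset Strict Implicit.
Unset Printing Implicit Defensive.

Import Order.TTheory GRing.Theory Num.Theory.
Import numFieldNormedType.Exports.

Local Open Scope classical_set_scope.
Local Open Scope ring_scope.

Section Euclidean.
Context {R : realType}.
Implicit Types u v p c x : 'rV[R]_3.

Definition dot u v : R := (u *m v^T) 0 0.

(* The library's norm on ['rV[R]_3] is the max norm, so it cannot be used to
   define balls; it does induce the usual topology of R^3. *)
Definition enorm v : R := Num.sqrt (dot v v).

Definition unit_ball c : set 'rV[R]_3 := [set x | enorm (x - c) <= 1].

Definition line_through p v : set 'rV[R]_3 := [set p + t *: v | t in setT].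

Definition non_overlapping (F : set (set 'rV[R]_3)) : Prop :=
  trivIset F (@interior 'rV[R]_3).

End Euclidean.

Record line (R : realType) := Line {
  line_set :> set 'rV[R]_3;
  line_setP : exists p v, v != 0 /\ line_set = line_through p v }.

HB.instance Definition _ (R : realType) := gen_eqMixin (line R).
HB.instance Definition _ (R : realType) := gen_choiceMixin (line R).

Section LineTopology.
Context {R : realType}.

Definition mkline (p v : 'rV[R]_3) (v0 : v != 0) : line R :=
  Line (ex_intro _ p (ex_intro _ v (conj v0 erefl))).

(* Quotient topology of { (p, v) | v <> 0 } under (p, v) |-> p + R v; since
   that domain is open, its open subsets are those open in R^3 * R^3. *)
Definition line_open (U : set (line R)) : Prop :=
  open [set pv : 'rV[R]_3 * 'rV[R]_3 |
         exists v0 : pv.2 != 0, U (mkline pv.1 v0)].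

Lemma line_openT : line_open setT.
Proof.
rewrite /line_open.
rewrite (_ : [set pv | _] = snd @^-1` (~` [set 0 : 'rV[R]_3])).
  apply: open_comp; first by move=> x _; exact: cvg_snd.
  by apply: closed_openC; exact/accessible_closed_set1/hausdorff_accessible.
apply/seteqP; split => -[p v] /=; first by case=> /eqP.
by move=> /eqP v0; exists v0.
Qed.

Lemma line_openI : setI_closed line_open.
Proof.
move=> U V oU oV; rewrite /line_open; move: (openI oU oV); congr open.
apply/seteqP; split => -[p v] /=.
  by move=> [[v0 Ux] [v1 Vx]]; exists v0; split => //; rewrite (bool_irrelevance v0 v1).
by move=> [v0 [Ux Vx]]; split; exists v0.
Qed.

Lemma line_open_bigU (I : Type) (f : I -> set (line R)) :
  (forall i, line_open (f i)) -> line_open (\bigcup_i f i).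
Proof.
move=> of_; rewrite /line_open.
move: (@bigcup_open _ I setT _ (fun i _ => of_ i)); congr open.
apply/seteqP; split => -[p v] /=.
  by move=> [i _ [v0 fi]]; exists v0; exists i.
by move=> [v0 [i _ fi]]; exists i => //; exists v0.
Qed.

HB.instance Definition _ :=
  isOpenTopological.Build (line R) line_openT line_openI line_open_bigU.

End LineTopology.

Section Transversals.
Context {R : realType}.
Implicit Types (F : set (set 'rV[R]_3)) (l : line R).

(* For a closed ball [X] of positive radius, a line is tangent at [c] exactly
   when it meets [X] in the single point [c]. *)
Definition tangent_at l (X : set 'rV[R]_3) (c : 'rV[R]_3) : Prop :=
  l `&` X = [set c].

(* Two distinct non-overlapping balls touch at [c] exactly when their
   intersection is [[set c]]. *)
Definition line_transversal F : set (line R) := [set l : line R |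
  (forall X, F X -> l `&` X !=set0) /\
  (forall X Y c, F X -> F Y -> X <> Y -> X `&` Y = [set c] ->
     ~ (tangent_at l X c /\ tangent_at l Y c))].

Definition pins F l : Prop := isolated (line_transversal F) l.

Definition direction l (v : 'rV[R]_3) : Prop :=
  v != 0 /\ exists p, l = line_through p v :> set _.

(* [s] lists the centers of the balls; the existential over [v] covers both
   orientations of [l]. *)
Definition realizes l (s : seq 'rV[R]_3) : Prop :=
  exists2 v, direction l v & pairwise (fun x y => 0 < dot v (y - x)) s.

End Transversals.

(* Main.v *)
(* A line pinned by a triple of the balls must touch all three at their tips: take
   the line as first coordinate axis; if the centers, in order along it, are not
   (x1, 1, 0), (y1, -1, 0), (z1, 1, 0) in suitable coordinates, some motion of the
   line keeps meeting the three balls to first order, and by convexity arbitrarily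
   small multiples of that motion do. Let c = sqrt (1 - v1^2) for the unit direction
   v of the other line. The centers of two balls stabbed by that line are at distance
   at most 2 transversally to v, so a difference D of two such centers has
   |D1 - (v . D) v1| <= 2 c. If the three balls occur in the same order on both
   lines, the lines coincide, since the middle ball lies below the first axis and
   the other two above it. In each remaining case the bound above, the separation
   of the centers and the two orders of the balls contradict each other. *)

Require Import Defs.
From mathcomp Require Import all_boot all_order all_algebra.
From mathcomp Require Import all_classical all_reals all_analysis.
From mathcomp Require Import ring lra.

Import Order.TTheory GRing.Theory Num.Theory.
Import numFieldNormedType.Exports.

Local Open Scope classical_set_scope.
Local Open Scope ring_scope.

(** * Inequalities in coordinates *)

Lemma sqr_le_mono (R : realDomainType) (x y : R) :
  0 <= x -> x <= y -> x ^+ 2 <= y ^+ 2.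
Proof. by move=> x0 xy; rewrite lerXn2r // nnegrE // (le_trans x0). Qed.

Lemma le_of_sqr_le (R : realDomainType) (x y : R) :
  0 <= y -> x ^+ 2 <= y ^+ 2 -> x <= y.
Proof. by move=> y0; rewrite !leNgt; apply: contra => yx; rewrite ltrXn2r. Qed.

Lemma lt_of_sqr_lt (R : realDomainType) (x y : R) :
  0 <= y -> x ^+ 2 < y ^+ 2 -> x < y.
Proof. by move=> y0; rewrite !ltNge; apply: contra; exact: sqr_le_mono. Qed.

Lemma exists_sqrt (R : rcfType) (x : R) :
  0 <= x -> exists2 r, 0 <= r & r ^+ 2 = x.
Proof. by move=> x0; exists (Num.sqrt x); rewrite ?sqrtr_ge0 ?sqr_sqrtr. Qed.

(* [D] is the difference of two points within distance 1 of a line of direction [v]. *)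
Lemma stab_first (R : realFieldType) (v1 v2 v3 D1 D2 D3 l : R) :
  v1 ^+ 2 + v2 ^+ 2 + v3 ^+ 2 = 1 -> l = v1 * D1 + v2 * D2 + v3 * D3 ->
  D1 ^+ 2 + D2 ^+ 2 + D3 ^+ 2 - l ^+ 2 <= 4 ->
  (D1 - l * v1) ^+ 2 <= 4 * (1 - v1 ^+ 2).
Proof.
move=> v_unit lE stab.
have v3E : v3 ^+ 2 = 1 - v1 ^+ 2 - v2 ^+ 2 by rewrite -v_unit; ring.
(* Lagrange's identity in the plane orthogonal to [v], for the projections of [D] and of the first
   basis vector, whose squared length is [1 - v1 ^+ 2]. *)
have -> : (D1 - l * v1) ^+ 2 =
  (1 - v1 ^+ 2) * (D1 ^+ 2 + D2 ^+ 2 + D3 ^+ 2 - l ^+ 2) - (v2 * D3 - v3 * D2) ^+ 2.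
  by rewrite lE; ring: v3E.
have := sqr_ge0 (v2 * D3 - v3 * D2); have := sqr_ge0 v2; have := sqr_ge0 v3.
nra.
Qed.

(* In the lemmas [coord_excl_*] the first axis is the pinned line, with
   [x2 = z2 = 1], [y2 = -1], [x3 = y3 = z3 = 0]; [w] is the fourth center, [v] the
   unit direction of the other line. Here [k = z1 - x1] and [L = z1 - w1]. *)
Lemma coord_excl_first (R : realFieldType) (k L e2 e3 v1 v2 v3 : R) :
  v1 ^+ 2 + v2 ^+ 2 + v3 ^+ 2 = 1 ->
  0 < v1 * - k -> 2 <= k -> k < L ->
  0 < v1 * L + v2 * e2 + v3 * e3 ->
  L ^+ 2 + e2 ^+ 2 + e3 ^+ 2 - (v1 * L + v2 * e2 + v3 * e3) ^+ 2 <= 4 -> False.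
Proof.
move=> v_unit v1k k2 kL; move lE : (v1 * L + _ + _) => l l0 stab.
have := stab_first _ _ _ _ _ _ _ _ v_unit (esym lE) stab.
have v1n : v1 < 0 by nra.
have lv: l * v1 < 0 by nra.
have h: 2 < L - l * v1 by lra.
have := sqr_ge0 v1.
nra.
Qed.

(* [t = z1 - y1] and [g = w1 - y1]. *)
Lemma coord_excl_mid (R : realFieldType) (t g w2 w3 v1 v2 v3 : R) :
  v1 ^+ 2 + v2 ^+ 2 + v3 ^+ 2 = 1 ->
  0 < g -> g < t -> w2 ^+ 2 + w3 ^+ 2 <= 1 ->
  4 <= g ^+ 2 + (w2 + 1) ^+ 2 + w3 ^+ 2 ->
  4 <= (t - g) ^+ 2 + (w2 - 1) ^+ 2 + w3 ^+ 2 ->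
  0 < v1 -> 0 < v1 * - t + v2 * - 2 ->
  (- t) ^+ 2 + (- 2) ^+ 2 - (v1 * - t + v2 * - 2) ^+ 2 <= 4 -> False.
Proof.
move=> v_unit g0 gt w1 wy wz v10; move lE : (_ + v2 * _) => l l0 stab.
have lE' : l = v1 * - t + v2 * - 2 + v3 * 0 by rewrite -lE; ring.
have stab' : (- t) ^+ 2 + (- 2) ^+ 2 + 0 ^+ 2 - l ^+ 2 <= 4 by rewrite expr0n addr0.
have := stab_first _ _ _ _ _ _ _ _ v_unit lE' stab'.
(* Adding the two separations and using [w2 ^+ 2 + w3 ^+ 2 <= 1] gives [g ^+ 2 + (t - g) ^+ 2 >= 4];
   the cross term is positive. *)
have t2 : 4 < t ^+ 2 by nra.
have lv: 0 < l * v1 by nra.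
have := sqr_ge0 v1.
nra.
Qed.

(* [s = y1 - x1], [t = z1 - y1] and [g = y1 - w1]. *)
Lemma coord_excl_between (R : rcfType) (s t g w2 w3 v1 v2 v3 : R) :
  v1 ^+ 2 + v2 ^+ 2 + v3 ^+ 2 = 1 ->
  0 < g -> g < s -> 0 < t -> w2 ^+ 2 + w3 ^+ 2 <= 1 ->
  4 <= (s - g) ^+ 2 + (w2 - 1) ^+ 2 + w3 ^+ 2 ->
  4 <= g ^+ 2 + (w2 + 1) ^+ 2 + w3 ^+ 2 ->
  4 <= (g + t) ^+ 2 + (w2 - 1) ^+ 2 + w3 ^+ 2 ->
  0 < v1 ->
  (s + t) ^+ 2 - (v1 * (s + t)) ^+ 2 <= 4 ->
  0 < v1 * - (g + t) + v2 * (w2 - 1) + v3 * w3 ->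
  (- (g + t)) ^+ 2 + (w2 - 1) ^+ 2 + w3 ^+ 2 -
    (v1 * - (g + t) + v2 * (w2 - 1) + v3 * w3) ^+ 2 <= 4 ->
  False.
Proof.
move=> v_unit g0 gs t0 w1 wx wy wz v10 st; move lE : (_ + _ + v3 * _) => l l0 stab.
have := stab_first _ _ _ _ _ _ _ _ v_unit (esym lE) stab.
set h := g + t in stab lE wz *.
have h0 : 0 < h by rewrite /h; lra.
have gh : g < h by rewrite /h; lra.
have hst : s + t = (s - g) + h by rewrite /h; ring.
have [r r0 r2] := exists_sqrt _ ((w2 - 1) ^+ 2 + w3 ^+ 2)
  (addr_ge0 (sqr_ge0 _) (sqr_ge0 _)).
(* Parallelogram identity: [w] is at transverse distance [r] from [x] and [z], hence at most [k]
   from [y], where [k ^+ 2 + r ^+ 2 = 4]. *)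
have w2r : (w2 + 1) ^+ 2 + w3 ^+ 2 <= 4 - r ^+ 2 by rewrite r2; nra.
have [k k0 k2] : exists2 k, 0 <= k & k ^+ 2 = 4 - r ^+ 2.
  apply: exists_sqrt; apply: le_trans w2r.
  by rewrite addr_ge0 ?sqr_ge0.
have [c c0 c2] : exists2 c, 0 <= c & c ^+ 2 = 1 - v1 ^+ 2.
  apply: exists_sqrt.
  by rewrite -v_unit; have := sqr_ge0 v2; have := sqr_ge0 v3; lra.
move=> hc.
have {wy w2r} rg : r <= g by apply: le_of_sqr_le (ltW g0) _; lra.
have {wz} kh : k <= h by apply: le_of_sqr_le (ltW h0) _; rewrite k2 r2; lra.
have {wx} ksg : k <= s - g by apply: le_of_sqr_le; rewrite ?k2 ?r2; lra.
have {hc l0} h2c : h < 2 * c.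
  have lv := mulr_gt0 l0 v10; apply: lt_of_sqr_lt; first by lra.
  have := mulr_gt0 h0 lv; have := sqr_ge0 (l * v1).
  by rewrite [(2 * c) ^+ 2]exprMn c2; clear -hc; lra.
have {st} stc : (s + t) * c <= 2.
  by apply: le_of_sqr_le; rewrite ?exprMn ?c2; lra.
(* As [k + h <= s + t], the product is below [2 * c * (s + t) <= 4]. This is impossible when [k] and
   [r] are at most [h]. *)
have {stc h2c} : (k + h) * h < 4.
  have : (k + h) * h < (k + h) * (2 * c) by rewrite ltr_pM2l //; lra.
  have : (k + h) * c <= (s + t) * c by rewrite ler_wpM2r // hst; lra.
  by lra.
have {rg gh} rh : r <= h by lra.
clear -k0 k2 r0 kh rh; case: (leP r k) => rk kh4.
  have := sqr_le_mono _ _ _ r0 rk.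
  have := ler_pM (addr_ge0 k0 k0) k0 (lerD (lexx k) kh) kh.
  by lra.
have : (k + r) * r <= (k + h) * h by rewrite ler_pM ?addr_ge0 ?lerD.
have : k * k <= k * r by rewrite ler_wpM2l // ltW.
lra.
Qed.

(* Outside the disc of radius 2, the points [(g, q)] of the wedge between the
   directions [(c, v)] and [(v, c)] lie beyond the chord [q + g = 2 (c + v)]. *)
Lemma wedge_chord (R : realFieldType) (g q c v : R) :
  0 < v -> v < c -> c ^+ 2 = 1 - v ^+ 2 -> 0 <= q -> q <= g ->
  4 <= g ^+ 2 + q ^+ 2 -> g * v <= c * q ->
  2 * c * v * (c + v) <= q * c ^+ 2 + g * v ^+ 2.
Proof.
move=> v0 cv c2 q0 qg g2 gq.
have chord : 2 * (c + v) <= q + g.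
  apply: le_of_sqr_le; first by lra.
  (* The product of the two wedge conditions gives [q * g >= c * v * (g ^+ 2 + q ^+ 2)], because
     [c ^+ 2 + v ^+ 2 = 1]. *)
  have : 0 <= (c * q - v * g) * (c * g - v * q).
    apply: mulr_ge0; first by lra.
    by rewrite subr_ge0 ler_pM //; lra.
  have -> : (c * q - v * g) * (c * g - v * q) =
    q * g - c * v * (g ^+ 2 + q ^+ 2) by ring: c2.
  have : 0 <= (g ^+ 2 + q ^+ 2 - 4) * (1 + 2 * (c * v)).
    apply: mulr_ge0; first by lra.
    by rewrite addr_ge0 ?mulr_ge0 //; lra.
  lra.
have -> : q * c ^+ 2 + g * v ^+ 2 =
  c * v * (q + g) + (c - v) * (c * q - g * v) by ring.
have : 0 <= c * v * (q + g - 2 * (c + v)) by rewrite !mulr_ge0 //; lra.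
have : 0 <= (c - v) * (c * q - g * v) by rewrite mulr_ge0; lra.
lra.
Qed.

(** Endgame of [coord_excl_last], with [v] the first coordinate of the direction and [c] its
    transverse length. Lowering [s] to [2 - t] only lowers the left side of the last inequality; it
    still reaches the right side, by a bound on [q] if [c <= v] and by [wedge_chord] otherwise. *)
Lemma last_wedge (R : realFieldType) (s t q c v : R) :
  0 < s -> 0 < t -> 0 < q -> 2 <= s + t -> 0 < v -> 0 <= c ->
  c ^+ 2 = 1 - v ^+ 2 -> 4 <= (t + q) ^+ 2 + q ^+ 2 -> (t + q) * v < c * q ->
  s * c ^+ 2 + (t + q) < 2 * c * (1 + v) -> False.
Proof.
move=> s0 t0 q0 st v0 c0 c2 g2 gq key.
have st0 : 0 <= (s + t - 2) * c ^+ 2 by rewrite mulr_ge0 ?sqr_ge0 //; lra.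
have c1 : c < 1.
  by apply: lt_of_sqr_lt => //; rewrite expr1n c2; have := exprn_gt0 2 v0; lra.
case: (leP c v) => cv.
  (* Otherwise [t + q >= 2 * c], whence [(t + q) * v >= 2 * c * v >= c * q]. *)
  have vq : 2 * v < q.
    rewrite ltNge; apply/negP => qv; clear st0 key c1.
    have qv2 := sqr_le_mono _ _ _ (ltW q0) qv.
    have cg : 2 * c <= t + q by apply: le_of_sqr_le; rewrite ?exprMn ?c2; lra.
    have : 2 * c * v <= (t + q) * v by rewrite ler_pM2r.
    have : c * q <= c * (2 * v) by rewrite ler_wpM2l.
    by lra.
  have : 0 <= t * (1 - c ^+ 2) by rewrite c2 mulr_ge0 ?(ltW t0) //; have := sqr_ge0 v; lra.
  have : 0 <= (1 - c) * (v - c) by rewrite mulr_ge0; lra.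
  by lra.
have := wedge_chord _ (t + q) q c v v0 cv c2 (ltW q0) _ g2 (ltW gq).
move=> /(_ ltac:(lra)).
have -> : (t + q) * v ^+ 2 = (t + q) - (t + q) * c ^+ 2 by rewrite c2; ring.
have : 0 <= c * ((1 - c) * (c - v)) by rewrite !mulr_ge0; lra.
have -> : c * ((1 - c) * (c - v)) = c * (c * (1 + v) + v ^+ 2 - 1 - v).
  by ring: c2.
by lra.
Qed.

(* [s = y1 - x1], [t = z1 - y1] and [q = w1 - z1]. *)
Lemma coord_excl_last (R : rcfType) (s t q w2 w3 v1 v2 v3 : R) :
  v1 ^+ 2 + v2 ^+ 2 + v3 ^+ 2 = 1 ->
  0 < s -> 0 < t -> 0 < q -> 2 <= s + t -> w2 ^+ 2 + w3 ^+ 2 <= 1 ->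
  4 <= q ^+ 2 + (w2 - 1) ^+ 2 + w3 ^+ 2 ->
  4 <= (t + q) ^+ 2 + (w2 + 1) ^+ 2 + w3 ^+ 2 ->
  0 < v1 ->
  0 < v1 * - (t + q) + v2 * - (w2 + 1) + v3 * - w3 ->
  (s + t + q) ^+ 2 + (w2 - 1) ^+ 2 + w3 ^+ 2 -
   (v1 * (s + t + q) + v2 * (w2 - 1) + v3 * w3) ^+ 2 <= 4 ->
  False.
Proof.
move=> v_unit s0 t0 q0 st w1 wz wy v10 yw.
move lE : (v1 * (s + t + q) + _ + v3 * _) => l stab.
have := stab_first _ _ _ _ _ _ _ _ v_unit (esym lE) stab.
have [r r0 r2] := exists_sqrt _ ((w2 + 1) ^+ 2 + w3 ^+ 2)
  (addr_ge0 (sqr_ge0 _) (sqr_ge0 _)).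
have v23 : v2 ^+ 2 + v3 ^+ 2 = 1 - v1 ^+ 2 by rewrite -v_unit; ring.
have [c c0 c2] := exists_sqrt _ (v2 ^+ 2 + v3 ^+ 2)
  (addr_ge0 (sqr_ge0 _) (sqr_ge0 _)).
rewrite -v23 -c2 => hc.
have {wz w1} rq : r <= q by apply: le_of_sqr_le (ltW q0) _; rewrite r2; lra.
have gr : v2 * - (w2 + 1) + v3 * - w3 <= c * r.
  apply: le_of_sqr_le; rewrite ?mulr_ge0 // exprMn c2 r2 -subr_ge0.
  rewrite (_ : _ - _ = (v2 * w3 - v3 * (w2 + 1)) ^+ 2) ?sqr_ge0 //; ring.
have cr : c * r <= c * q by rewrite ler_wpM2l.
have r2q := sqr_le_mono _ _ _ r0 rq.
have v2c : - v2 <= c.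
  by apply: le_of_sqr_le => //; rewrite sqrrN c2; have := sqr_ge0 v3; lra.
(* Split [w - x] at [y]: the part [w - y] contributes a negative amount, and [y - x] is
   [(s, -2, 0)]. *)
have l_lt : l < s * v1 + 2 * c by lra.
have Llv : s + t + q - l * v1 <= 2 * c.
  by apply: le_of_sqr_le; rewrite ?exprMn; lra.
have lv : l * v1 < (s * v1 + 2 * c) * v1 by rewrite ltr_pM2r.
apply: (last_wedge _ s t q c v1) => //; rewrite ?c2 //.
- by move: wy; rewrite -addrA -r2; clear -r2q; lra.
- by clear -gr cr yw; lra.
- by rewrite v23; clear -lv Llv; lra.
Qed.

(** * Euclidean structure *)

Section Dot.
Context {R : realType}.
Implicit Types (p q u v w : 'rV[R]_3) (k : R).

Lemma dotE u v :
  dot u v = u 0 0 * v 0 0 + u 0 1 * v 0 1 + u 0 (2 : 'I_3) * v 0 (2 : 'I_3).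
Proof.
rewrite /dot mxE !big_ord_recr big_ord0 /= add0r !mxE.
by congr (u _ _ * v _ _ + u _ _ * v _ _ + u _ _ * v _ _); apply/val_inj.
Qed.

Lemma dotC u v : dot u v = dot v u.
Proof. by rewrite !dotE; ring. Qed.

Lemma dotDl u v w : dot (u + v) w = dot u w + dot v w.
Proof. by rewrite /dot mulmxDl mxE. Qed.

Lemma dotZl k u v : dot (k *: u) v = k * dot u v.
Proof. by rewrite /dot -scalemxAl mxE. Qed.

Lemma dotDr u v w : dot w (u + v) = dot w u + dot w v.
Proof. by rewrite ![dot w _]dotC dotDl. Qed.

Lemma dotZr k u v : dot v (k *: u) = k * dot v u.
Proof. by rewrite ![dot v _]dotC dotZl. Qed.

Lemma dotNl u v : dot (- u) v = - dot u v.
Proof. by rewrite -scaleN1r dotZl mulN1r. Qed.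

Lemma dotNr u v : dot v (- u) = - dot v u.
Proof. by rewrite ![dot v _]dotC dotNl. Qed.

Lemma dot0l u : dot 0 u = 0.
Proof. by rewrite -(scale0r 0) dotZl mul0r. Qed.

Definition dotlin := (dotDl, dotDr, dotZl, dotZr, dotNl, dotNr).

Lemma dot_ge0 u : 0 <= dot u u.
Proof. by rewrite dotE !addr_ge0 // -expr2 sqr_ge0. Qed.

Lemma dot_eq0 u : dot u u <= 0 -> u = 0.
Proof.
rewrite dotE => u0.
have [u00 u01 u02] : [/\ u 0 0 = 0, u 0 1 = 0 & u 0 (2 : 'I_3) = 0].
  have := sqr_ge0 (u 0 0); have := sqr_ge0 (u 0 1); have := sqr_ge0 (u 0 (2 : 'I_3)).
  by split; apply/eqP; rewrite -sqrf_eq0; apply/eqP; lra.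
apply/rowP => -[[|[|[|//]]] i3]; rewrite mxE.
- by rewrite -u00; congr (u _ _); apply/val_inj.
- by rewrite -u01; congr (u _ _); apply/val_inj.
- by rewrite -u02; congr (u _ _); apply/val_inj.
Qed.

Lemma dot_gt0 u : u != 0 -> 0 < dot u u.
Proof. by move=> u0; rewrite ltNge; apply: contra_neqN u0 => /dot_eq0. Qed.

Lemma exists_orthogonal u : exists2 w, w != 0 & dot w u = 0.
Proof.
have [u0|u0] := eqVneq (u 0 0 ^+ 2 + u 0 1 ^+ 2) 0.
  exists (\row_j (j == 0)%:R).
    by apply/eqP => /rowP/(_ 0); rewrite !mxE => /eqP; rewrite oner_eq0.
  rewrite dotE !mxE /= !mul0r !addr0 mul1r; apply/eqP; rewrite -sqrf_eq0; apply/eqP.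
  by have := sqr_ge0 (u 0 0); have := sqr_ge0 (u 0 1); lra.
exists (\row_j (if j == 0 then - u 0 1 else if j == 1 then u 0 0 else 0)).
  apply: contra_neq u0 => /rowP w0.
  have := w0 0; have := w0 1; rewrite !mxE /= => -> /eqP.
  by rewrite oppr_eq0 => /eqP ->; ring.
by rewrite dotE !mxE /=; ring.
Qed.

(** [m] is the cross product of [u] and [n]. The matrix [M] with rows [u], [n], [m] satisfies
    [M *m M^T = 1], hence also [M^T *m M = 1], which is Parseval's identity. *)
Lemma orthonormal_frame u n :
  dot u u = 1 -> dot n n = 1 -> dot u n = 0 ->
  exists m, [/\ dot u m = 0, dot n m = 0 &
    forall p q, dot p q = dot p u * dot q u + dot p n * dot q n + dot p m * dot q m].
Proof.
move=> uu nn un.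
pose m : 'rV[R]_3 := \row_j (if j == 0 then u 0 1 * n 0 2 - u 0 2 * n 0 1 else
  if j == 1 then u 0 2 * n 0 0 - u 0 0 * n 0 2 else u 0 0 * n 0 1 - u 0 1 * n 0 0).
have um : dot u m = 0 by rewrite dotE !mxE /=; ring.
have nm : dot n m = 0 by rewrite dotE !mxE /=; ring.
have mm : dot m m = 1.
  transitivity (dot u u * dot n n - dot u n ^+ 2); last by rewrite uu nn un; ring.
  by rewrite !dotE !mxE /=; ring.
clearbody m; exists m; split => // p q.
pose M : 'M[R]_3 :=
  \matrix_(i, j) (if i == 0 then u 0 j else if i == 1 then n 0 j else m 0 j).
have ME i p' : (p' *m M^T) 0 i = dot p' (row i M).
  by rewrite /dot !mxE; apply: eq_bigr => j _; rewrite !mxE.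
have rowM i : row i M = if i == 0 then u else if i == 1 then n else m.
  by apply/rowP => j; rewrite !mxE; case: (i == 0); case: (i == 1).
have MM : M *m M^T = 1%:M.
  apply/matrixP => i j.
  have -> : (M *m M^T) i j = dot (row i M) (row j M).
    by rewrite -ME -row_mul [RHS]mxE.
  rewrite !rowM mxE; case: i => [[|[|[|//]]] i3]; case: j => [[|[|[|//]]] j3];
  by rewrite -?val_eqE /= ?mulr1n ?mulr0n ?uu ?nn ?mm ?un ?um ?nm // dotC.
have pq : dot p q = dot (p *m M^T) (q *m M^T).
  by rewrite /dot trmx_mul trmxK mulmxA -(mulmxA p) (mulmx1C MM) mulmx1.
by rewrite pq dotE !ME !rowM.
Qed.

End Dot.

(** * Unit balls and stabbing lines *)

Section Lines.
Context {R : realType}.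
Implicit Types (o p q u v x y z f h m : 'rV[R]_3) (l : line R).

(* For a unit vector [u], the line [o + R u] meets the unit ball at [x]. *)
Definition stabs o u x : Prop := dot (x - o) (x - o) - dot (x - o) u ^+ 2 <= 1.

Lemma unit_ballP c p : unit_ball c p <-> dot (p - c) (p - c) <= 1.
Proof. by rewrite /unit_ball /enorm /= -{1}(sqrtr1 R) ler_sqrt ?ler01. Qed.

Lemma line_throughP o v p : line_through o v p <-> exists t, p = o + t *: v.
Proof. by split; move=> [t]; [move=> _ <-|move=> ->]; exists t. Qed.

Lemma line_throughZ o v k : k != 0 -> line_through o (k *: v) = line_through o v.
Proof.
move=> k0; apply/seteqP; split => p /line_throughP[t ->]; apply/line_throughP.
  by exists (t * k); rewrite scalerA.
by exists (t / k); rewrite scalerA divfK.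
Qed.

Lemma line_inj l l' : l = l' :> set _ -> l = l'.
Proof.
case: l l' => [L PL] [L' PL'] /= E; case: _ / E PL' => PL'.
by congr Line; exact: Prop_irrelevance.
Qed.

Lemma realizes_unit l s : realizes l s -> exists o u, [/\ dot u u = 1,
  l = line_through o u :> set _ & pairwise (fun x y => 0 < dot u (y - x)) s].
Proof.
move=> [v [v0 [ o lE]] s_v]; have vv := dot_gt0 _ v0.
have k0 : 0 < (Num.sqrt (dot v v))^-1 by rewrite invr_gt0 sqrtr_gt0.
exists o, ((Num.sqrt (dot v v))^-1 *: v); split.
- by rewrite !dotlin mulrA -expr2 exprVn sqr_sqrtr ?(ltW vv) // mulVf // gt_eqF.
- by rewrite line_throughZ // gt_eqF.
- by apply: sub_pairwise s_v => x y xy; rewrite dotZl mulr_gt0.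
Qed.

Lemma meets_stabs o u x : dot u u = 1 ->
  line_through o u `&` unit_ball x !=set0 -> stabs o u x.
Proof.
move=> uu [p [/line_throughP[t ->]] /unit_ballP].
have -> : o + t *: u - x = t *: u - (x - o) by rewrite opprB addrA (addrC o).
rewrite /stabs; move: (x - o) => d; rewrite !dotlin uu (dotC d u).
by have := sqr_ge0 (t - dot u d); lra.
Qed.

(** Parallelogram identity for the components of the two centers orthogonal to [u], each of length
    at most 1; [w] is their sum. *)
Lemma stabs_dist o u x y : dot u u = 1 -> stabs o u x -> stabs o u y ->
  dot (y - x) (y - x) - dot u (y - x) ^+ 2 <= 4.
Proof.
have -> : y - x = (y - o) - (x - o) by rewrite opprB addrA subrK.
rewrite /stabs; move: (x - o) (y - o) => a b uu sa sb.
pose w := (a + b) - (dot a u + dot b u) *: u.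
have := dot_ge0 w; rewrite /w !dotlin uu.
by rewrite (dotC b a) (dotC u a) (dotC u b); lra.
Qed.

Lemma unit_ball_interior c p : dot (p - c) (p - c) < 1 ->
  @interior 'rV[R]_3 (unit_ball c) p.
Proof.
move=> pc.
have cont : dot (q - c) (q - c) @[q --> p] --> dot (p - c) (p - c).
  have coordB i : (q 0 i - c 0 i) @[q --> p] --> p 0 i - c 0 i.
    by apply: cvgB; [exact: coord_continuous|exact: cvg_cst].
  have -> : (fun q => dot (q - c) (q - c)) = (fun q : 'rV[R]_3 =>
    (q 0 0 - c 0 0) * (q 0 0 - c 0 0) + (q 0 1 - c 0 1) * (q 0 1 - c 0 1) +
    (q 0 (2 : 'I_3) - c 0 (2 : 'I_3)) * (q 0 (2 : 'I_3) - c 0 (2 : 'I_3))).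
    by apply/funext => q; rewrite dotE !mxE.
  rewrite dotE !mxE.
  exact: cvgD (cvgD (cvgM (coordB _) (coordB _)) (cvgM (coordB _) (coordB _)))
    (cvgM (coordB _) (coordB _)).
change (nbhs p (unit_ball c)).
by apply: filterS (cvgr_lt _ cont _ pc) => q /ltW /unit_ballP.
Qed.

(** The point of the ball around [a] farthest from [b] is at distance more than 1 from [b].
    Injectivity lets [non_overlapping], a condition on sets, speak of centers. *)
Lemma unit_ball_inj : injective (@unit_ball R).
Proof.
move=> a b ab; apply/eqP; rewrite -subr_eq0; apply/negP => /negP ab0.
have d0 := dot_gt0 _ ab0.
have s0 : 0 < Num.sqrt (dot (a - b) (a - b)) by rewrite sqrtr_gt0.
have s2 := sqr_sqrtr (ltW d0).
move: s0 s2; set s := Num.sqrt _ => s0 s2.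
have s1 : s^-1 * s = 1 by rewrite mulVf // gt_eqF.
have : unit_ball a (a + s^-1 *: (a - b)).
  apply/unit_ballP; rewrite [a + _]addrC addrK dotZl dotZr -s2.
  have -> : s^-1 * (s^-1 * s ^+ 2) = (s^-1 * s) ^+ 2 by ring.
  by rewrite s1 expr1n.
rewrite ab => /unit_ballP.
have -> : a + s^-1 *: (a - b) - b = (1 + s^-1) *: (a - b).
  by rewrite scalerDl scale1r addrAC.
rewrite dotZl dotZr -s2.
have -> : (1 + s^-1) * ((1 + s^-1) * s ^+ 2) = (s + s^-1 * s) ^+ 2 by ring.
by rewrite s1; have := exprn_gt0 2 s0; lra.
Qed.

(** The midpoint of centers closer than 2 would be interior to both balls. *)
Lemma non_overlapping_dist (F : set (set 'rV[R]_3)) x y : non_overlapping F ->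
  F (unit_ball x) -> F (unit_ball y) -> x != y -> 4 <= dot (x - y) (x - y).
Proof.
move=> Fno Fx Fy xy; rewrite leNgt; apply/negP => lt4.
move/eqP: xy; apply; apply: unit_ball_inj; apply: Fno => //.
exists (2^-1 *: (x + y)); split; apply: unit_ball_interior.
  have -> : 2^-1 *: (x + y) - x = - 2^-1 *: (x - y).
    by apply/rowP => j; rewrite !mxE; field.
  by rewrite dotZl dotZr; lra.
have -> : 2^-1 *: (x + y) - y = 2^-1 *: (x - y).
  by apply/rowP => j; rewrite !mxE; field.
by rewrite dotZl dotZr; lra.
Qed.

End Lines.

(** * Lines pinned by three balls *)

Section Pinning.
Context {R : realType}.
Implicit Types (o p q u v x y z f h m : 'rV[R]_3) (l : line R) (G : set (set 'rV[R]_3)).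

(** The foot of the perpendicular from [p] is no farther from [p] than [c], so it is a common point
    too and must be [c]. *)
Lemma tangent_orthogonal l o v p c : v != 0 -> l = line_through o v :> set _ ->
  tangent_at l (unit_ball p) c -> dot v (c - p) = 0.
Proof.
move=> v0 lE tan; have vv := dot_gt0 _ v0.
have [cl /unit_ballP cp] : (l `&` unit_ball p) c by rewrite tan.
pose k := dot v (c - p) / dot v v.
have kvv : k * dot v v = dot v (c - p) by rewrite /k divfK // gt_eqF.
have : (l `&` unit_ball p) (c - k *: v).
  split.
    move: cl; rewrite lE => /line_throughP[t ->]; apply/line_throughP.
    by exists (t - k); rewrite scalerBl addrA.
  apply/unit_ballP; rewrite addrAC; apply: le_trans cp.
  move: (c - p) kvv => d kvv; rewrite !dotlin (dotC d v) -kvv.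
  by have := mulr_ge0 (sqr_ge0 k) (ltW vv); lra.
rewrite tan => /= /eqP; rewrite -subr_eq0 addrAC subrr add0r oppr_eq0 scaler_eq0.
by rewrite (negbTE v0) orbF => /eqP k0; rewrite -kvv k0 mul0r.
Qed.

(** Used contrapositively: a line that strictly orders two centers cannot be tangent to both balls
    at one point. *)
Lemma tangent_touching l o v p q c : v != 0 -> l = line_through o v :> set _ ->
  tangent_at l (unit_ball p) c -> tangent_at l (unit_ball q) c ->
  dot v (q - p) = 0.
Proof.
move=> v0 lE /(tangent_orthogonal _ _ _ _ _ v0 lE) pc /(tangent_orthogonal _ _ _ _ _ v0 lE) qc.
by rewrite -(subrKA c) -[q - c]opprB dotDr dotNr pc qc oppr0 addr0.
Qed.

Lemma cvg_ray p f : p + e *: f @[e --> 0^'+] --> p.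
Proof.
rewrite -[X in _ --> X]addr0 -(scale0r f); apply: cvgD; first exact: cvg_cst.
by apply: cvgZr_tmp; apply: cvg_at_right_filter; exact: cvg_id.
Qed.

Lemma near_quadratic_lt (A B C r : R) : C < r ->
  \forall e \near 0^'+, e * (e * A + B) + C < r.
Proof.
have cv0 : e @[e --> (0 : R)^'+] --> (0 : R) by apply: cvg_at_right_filter; exact: cvg_id.
have : e * (e * A + B) + C @[e --> 0^'+] --> 0 * (0 * A + B) + C.
  apply: cvgD; last exact: cvg_cst.
  apply: cvgM => //; apply: cvgD; last exact: cvg_cst.
  by apply: cvgM => //; exact: cvg_cst.
by rewrite mul0r add0r => cv; exact: cvgr_lt.
Qed.

(* First-order condition for [e *: m] to stay in the unit ball at [p], which
   contains [0], for small [e > 0]. *)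
Definition pushes m p : Prop := dot p p < 1 \/ 0 < dot m p.

Lemma pushes_near m p : dot p p <= 1 -> pushes m p ->
  \forall e \near 0^'+, dot (e *: m - p) (e *: m - p) <= 1.
Proof.
move=> p1; case=> [plt1|mp].
  apply: filterS (near_quadratic_lt (dot m m) (- 2 * dot m p) (dot p p) 1 plt1) => e.
  by rewrite !dotlin (dotC p m); lra.
near=> e.
have e0 : 0 < e by near: e; exact: nbhs_right_gt.
have : e * (e * 0 + dot m m) + - 2 * dot m p < 0.
  by near: e; apply: near_quadratic_lt; lra.
rewrite mulr0 add0r => lt0; rewrite !dotlin (dotC p m).
have := mulr_gt0 e0 (_ : 0 < 2 * dot m p - e * dot m m).
by move=> /(_ ltac:(lra)); lra.
Unshelve. all: by end_near.
Qed.

Lemma pushes_self p : pushes p p.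
Proof.
have [->|p0] := eqVneq p 0; first by left; rewrite dot0l.
by right; exact: dot_gt0.
Qed.

Definition off o u p := p - o - dot (p - o) u *: u.

Lemma dot_off o u p : dot u u = 1 -> dot (off o u p) u = 0.
Proof. by move=> uu; rewrite /off dotDl dotNl dotZl uu; ring. Qed.

Lemma stabs_off o u p : dot u u = 1 ->
  stabs o u p <-> dot (off o u p) (off o u p) <= 1.
Proof.
move=> uu; rewrite /stabs /off; move: (p - o) => d.
by rewrite !dotlin uu (dotC u d) (_ : _ - _ * _ + _ = dot d d - dot d u ^+ 2) //; ring.
Qed.

(** The line moves so that the feet of [x] and [z] are displaced by [e *: mx] and [e *: mz]; the
    foot of [y] follows by interpolation with weight [k]. For small [e] all three balls stay met in
    strict order, so the moved line is a transversal near [l], hence [l] itself. *)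
Lemma pinned_rigid G l o u x y z mx mz (k := dot u (y - x) / dot u (z - x)) :
  pins G l -> G `<=` [set unit_ball x; unit_ball y; unit_ball z] ->
  l = line_through o u :> set _ -> dot u u = 1 ->
  0 < dot u (y - x) -> 0 < dot u (z - y) ->
  stabs o u x -> stabs o u y -> stabs o u z ->
  dot mx u = 0 -> dot mz u = 0 ->
  pushes mx (off o u x) -> pushes mz (off o u z) ->
  pushes ((1 - k) *: mx + k *: mz) (off o u y) -> mx = 0 /\ mz = 0.
Proof.
move=> pin Gsub lE uu xy yz sx sy sz mxu mzu px pz py.
have zxE : dot u (z - x) = dot u (z - y) + dot u (y - x) by rewrite -dotDr subrKA.
have xz : 0 < dot u (z - x) by rewrite zxE addr_gt0.
(* [h] and [f] solve [move_at x = mx] and [move_at z = mz]. *)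
pose h := (dot u (z - x))^-1 *: (mz - mx).
pose f := mx - dot (x - o) u *: h.
pose move_at p := f + dot (p - o) u *: h.
have move_atE p : move_at p = mx + (dot u (p - x) / dot u (z - x)) *: (mz - mx).
  rewrite /move_at /f -addrA; congr (_ + _).
  rewrite addrC -scalerBl /h scalerA; congr (_ *: _); congr (_ / _).
  by rewrite (dotC u) -dotNl -dotDl opprB addrA subrK.
have moveX : move_at x = mx by rewrite move_atE subrr dotC dot0l mul0r scale0r addr0.
have moveZ : move_at z = mz by rewrite move_atE divff ?gt_eqF // scale1r addrCA subrr addr0.
have moveY : move_at y = (1 - k) *: mx + k *: mz.
  by rewrite move_atE -/k scalerBr scalerBl scale1r addrA addrAC.
have [lG [V nV Vl]] := pin.
have [U [oU Ul] UV] : exists2 U, open_nbhs l U & U `<=` V by move: nV; rewrite nbhsE.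
have u0 : u != 0 by apply: contra_eq_neq uu => ->; rewrite dot0l eq_sym oner_eq0.
have lmk : mkline o u0 = l by apply: line_inj; rewrite lE.
pose W := [set pv : 'rV[R]_3 * 'rV[R]_3 | exists v0 : pv.2 != 0, U (mkline pv.1 v0)].
have oW : open W by exact: oU.
have Wou : W (o, u) by exists u0; rewrite lmk.
have nearW : \forall e \near 0^'+, W (o + e *: f, u + e *: h).
  have cv : (o + e *: f, u + e *: h) @[e --> (0 : R)^'+] --> (o, u).
    exact: (cvg_pair (cvg_ray o f) (cvg_ray u h)).
  exact: cv W (open_nbhs_nbhs (conj oW Wou)).
have near_dir a b : 0 < dot u (b - a) ->
    \forall e \near 0^'+, 0 < dot (u + e *: h) (b - a).
  move=> ab; apply: filterS (near_quadratic_lt 0 (- dot h (b - a)) (- dot u (b - a)) 0 _).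
    by move=> e; rewrite (dotDl u) (dotZl e h); lra.
  by lra.
have near_off p m : stabs o u p -> pushes m (off o u p) ->
    \forall e \near 0^'+, dot (e *: m - off o u p) (e *: m - off o u p) <= 1.
  by move=> /(stabs_off _ _ _ uu) p1 mp; exact: pushes_near.
near (0 : R)^'+ => e.
have e0 : 0 < e by near: e; exact: nbhs_right_gt.
have : W (o + e *: f, u + e *: h) by near: e.
move=> [/= v0 Ul'].
have meet p : dot (e *: move_at p - off o u p) (e *: move_at p - off o u p) <= 1 ->
    mkline (o + e *: f) v0 `&` unit_ball p !=set0.
  move=> mp; exists (o + e *: f + dot (p - o) u *: (u + e *: h)); split.
    by apply/line_throughP; eexists.
  apply/unit_ballP; rewrite (_ : _ - p = e *: move_at p - off o u p) //.
  by rewrite /move_at /off; apply/rowP => j; rewrite !mxE; ring.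
have meetX : mkline (o + e *: f) v0 `&` unit_ball x !=set0.
  by apply: meet; rewrite moveX; near: e; exact: near_off.
have meetY : mkline (o + e *: f) v0 `&` unit_ball y !=set0.
  by apply: meet; rewrite moveY; near: e; exact: near_off.
have meetZ : mkline (o + e *: f) v0 `&` unit_ball z !=set0.
  by apply: meet; rewrite moveZ; near: e; exact: near_off.
have dxy : 0 < dot (u + e *: h) (y - x) by near: e; exact: near_dir.
have dyz : 0 < dot (u + e *: h) (z - y) by near: e; exact: near_dir.
have dxz : 0 < dot (u + e *: h) (z - x) by near: e; exact: near_dir.
have newE :
    mkline (o + e *: f) v0 = line_through (o + e *: f) (u + e *: h) :> set _ by [].
have notouch p q c : 0 < dot (u + e *: h) (q - p) ->
    tangent_at (mkline (o + e *: f) v0) (unit_ball p) c ->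
    tangent_at (mkline (o + e *: f) v0) (unit_ball q) c -> False.
  move=> pq tp tq; move: pq.
  by rewrite (tangent_touching _ _ _ _ _ _ v0 newE tp tq) ltxx.
have trans : line_transversal G (mkline (o + e *: f) v0).
  split; first by move=> X /Gsub[[->|->]|->].
  move=> X Y c /Gsub[[->|->]|->] /Gsub[[->|->]|->] // _ _ [tX tY].
  - exact: notouch dxy tX tY.
  - exact: notouch dxz tX tY.
  - exact: notouch dxy tY tX.
  - exact: notouch dyz tX tY.
  - exact: notouch dxz tY tX.
  - exact: notouch dyz tY tX.
have same : mkline (o + e *: f) v0 = l.
  have : (V `&` line_transversal G) (mkline (o + e *: f) v0) by split => //; exact: UV.
  by rewrite Vl.
have sameE : line_through (o + e *: f) (u + e *: h) = line_through o u by rewrite -lE -same.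
(* The displaced foot is still on the line, so its displacement is also a multiple of [u]. *)
have fixed p : dot (move_at p) u = 0 -> move_at p = 0.
  move=> mpu.
  have : line_through (o + e *: f) (u + e *: h) (o + e *: f + dot (p - o) u *: (u + e *: h)).
    by apply/line_throughP; eexists.
  rewrite sameE => /line_throughP[t /eqP]; rewrite -addrA (inj_eq (addrI o)) => /eqP tE.
  have meq : e *: move_at p = (t - dot (p - o) u) *: u.
    by rewrite scalerBl -tE /move_at; apply/rowP => j; rewrite !mxE; ring.
  have t0 : t - dot (p - o) u = 0.
    by have := congr1 (dot ^~ u) meq; rewrite /= !dotZl uu mpu mulr0 mulr1.
  move: meq; rewrite t0 scale0r => /eqP; rewrite scaler_eq0 (gt_eqF e0) /=.
  by move/eqP.
by split; [rewrite -moveX; apply: fixed; rewrite moveX|rewrite -moveZ; apply: fixed; rewrite moveZ].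
Unshelve. all: by end_near.
Qed.

(** Any other configuration admits a nonzero pair [mx], [mz] pushing all three balls, against
    [pinned_rigid]. First the offsets get length 1, then the outer ones are opposite to the middle
    one. *)
Lemma pinned_alternating G l o u x y z :
  pins G l -> G `<=` [set unit_ball x; unit_ball y; unit_ball z] ->
  l = line_through o u :> set _ -> dot u u = 1 ->
  0 < dot u (y - x) -> 0 < dot u (z - y) ->
  stabs o u x -> stabs o u y -> stabs o u z ->
  exists n, [/\ dot n n = 1, dot u n = 0, off o u x = n, off o u y = - n & off o u z = n].
Proof.
move=> pin Gsub lE uu xy yz sx sy sz.
pose k := dot u (y - x) / dot u (z - x).
have rigid mx mz := pinned_rigid _ _ _ _ _ _ _ mx mz pin Gsub lE uu xy yz sx sy sz.
rewrite -/k in rigid.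
have zxE : dot u (z - x) = dot u (z - y) + dot u (y - x) by rewrite -dotDr subrKA.
have k0 : 0 < k by rewrite divr_gt0 // zxE addr_gt0.
have k1 : k < 1 by rewrite ltr_pdivrMr ?mul1r zxE ?addr_gt0 // ltrDr.
have xu := dot_off o _ x uu; have yu := dot_off o _ y uu; have zu := dot_off o _ z uu.
move: (sx) (sy) (sz) => /(stabs_off _ _ _ uu) x1 /(stabs_off _ _ _ uu) y1 /(stabs_off _ _ _ uu) z1.
move: (off o u x) (off o u y) (off o u z) rigid xu yu zu x1 y1 z1 => a b c rigid au bu cu a1 b1 c1.
have aa : dot a a = 1.
  apply/eqP; rewrite eq_le a1 leNgt; apply/negP => alt1.
  (* Displacing [x] this way displaces [y] by its own offset [b], which always pushes. *)
  have yE : (1 - k) *: ((1 - k)^-1 *: (b - k *: c)) + k *: c = b.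
    by rewrite scalerA mulfV ?scale1r ?subrK // subr_eq0 gt_eqF.
  have [||||| m0 c0] := rigid ((1 - k)^-1 *: (b - k *: c)) c => //.
  - by rewrite !dotlin bu cu mulr0 subrr mulr0.
  - by left.
  - exact: pushes_self.
  - by rewrite yE; exact: pushes_self.
  have b0 : b = 0 by rewrite -yE m0 c0 !scaler0 addr0.
  (* The line now passes through [y] and [z] and the interior of the first ball, so a tilt about [z]
     in any transverse direction is admissible. *)
  have [w w0 wu] := exists_orthogonal u.
  have [||||| w0' _] := rigid w 0 => //.
  - exact: dot0l.
  - by left.
  - by rewrite c0; exact: pushes_self.
  - by rewrite b0; left; rewrite dot0l.
  by rewrite w0' eqxx in w0.
have a0 : a = 0 -> False by move=> a0; move: aa; rewrite a0 dot0l => /eqP; rewrite eq_sym oner_eq0.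
have cc : dot c c = 1.
  apply/eqP; rewrite eq_le c1 leNgt; apply/negP => clt1; apply: a0.
  have yE : (1 - k) *: a + k *: (k^-1 *: (b - (1 - k) *: a)) = b.
    by rewrite scalerA mulfV ?gt_eqF // scale1r addrC subrK.
  have [||||| a0 _] := rigid a (k^-1 *: (b - (1 - k) *: a)) => //.
  - by rewrite !dotlin bu au mulr0 subrr mulr0.
  - exact: pushes_self.
  - by left.
  - by rewrite yE; exact: pushes_self.
have bb : dot b b = 1.
  apply/eqP; rewrite eq_le b1 leNgt; apply/negP => blt1; apply: a0.
  have [||||| a0 _] := rigid a c => //; try exact: pushes_self.
  by left.
have sum_unit p q : dot p p = 1 -> dot q q = 1 -> dot p q <= - 1 -> p = - q.
  move=> pp qq pq; apply/eqP; rewrite -addr_eq0; apply/eqP/dot_eq0.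
  by rewrite !dotlin pp qq (dotC q p); lra.
have cauchy p q : dot p p = 1 -> dot q q = 1 -> - 1 <= dot p q.
  move=> pp qq; have := dot_ge0 (p + q).
  by rewrite !dotlin pp qq (dotC q p); lra.
have ab : a = - b.
  apply: sum_unit => //; rewrite leNgt; apply/negP => ab.
  (* The push [a + b] gains [(1 - k) * (1 + dot a b)] at the middle ball. Half of that as factor of
     [c] keeps the possible loss, at most [k] times the factor, below the gain. *)
  have eta0 : 0 < (1 - k) * (1 + dot a b) / 2 by apply: divr_gt0; [apply: mulr_gt0; lra|lra].
  have [||||| w0 _] := rigid (a + b) (((1 - k) * (1 + dot a b) / 2) *: c).
  - by rewrite dotDl au bu addr0.
  - by rewrite dotZl cu mulr0.
  - by right; rewrite dotDl aa (dotC b a); lra.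
  - by right; rewrite dotZl cc mulr1.
  - right; rewrite !dotlin bb.
    have cb := cauchy c b cc bb; clear -k0 k1 ab cb eta0.
    set eta := _ / 2 in eta0 *.
    have etaE : (1 - k) * (1 + dot a b) = 2 * eta by rewrite /eta; field.
    clearbody eta.
    have : 0 <= k * (eta * (1 + dot c b))
      by apply: mulr_ge0; [lra|apply: mulr_ge0; lra].
    have : 0 < (1 - k) * eta by rewrite mulr_gt0 //; lra.
    by lra.
  by have := dot0l a; rewrite -w0 dotDl aa dotC; lra.
have cb : c = - b.
  apply: sum_unit => //; rewrite leNgt; apply/negP => cb.
  have eta0 : 0 < k * (1 + dot c b) / 2 by apply: divr_gt0; [apply: mulr_gt0; lra|lra].
  have [||||| _ w0] := rigid ((k * (1 + dot c b) / 2) *: a) (c + b).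
  - by rewrite dotZl au mulr0.
  - by rewrite dotDl cu bu addr0.
  - by right; rewrite dotZl aa mulr1.
  - by right; rewrite dotDl cc (dotC b c); lra.
  - right; rewrite !dotlin bb.
    have ab' := cauchy a b aa bb; clear -k0 k1 ab' cb eta0.
    set eta := _ / 2 in eta0 *.
    have etaE : k * (1 + dot c b) = 2 * eta by rewrite /eta; field.
    clearbody eta.
    have : 0 <= (1 - k) * (eta * (1 + dot a b))
      by apply: mulr_ge0; [lra|apply: mulr_ge0; lra].
    have : 0 < k * eta by rewrite mulr_gt0.
    by lra.
  by have := dot0l c; rewrite -w0 dotDl cc dotC; lra.
exists (- b); rewrite opprK; split => //.
- by rewrite dotNl dotNr opprK.
- by rewrite dotNr dotC bu oppr0.
Qed.

End Pinning.

(** * Exclusion of a fourth ball *)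

Section Exclusions.
Context {R : realType}.
Implicit Types (o p q u v w x y z n m : 'rV[R]_3).

(** The second coordinate is affine along the line with signs [>= 0], [<= 0], [>= 0] at
    [rx < ry < rz], so it vanishes identically; the two outer points then have third coordinate
    0. *)
Lemma alternating_foot_lines (x1 z1 o1 o2 o3 v1 v2 v3 rx ry rz y1 : R) :
  rx < ry -> ry < rz ->
  (o1 + rx * v1 - x1) ^+ 2 + (o2 + rx * v2 - 1) ^+ 2 + (o3 + rx * v3) ^+ 2 <= 1 ->
  (o1 + ry * v1 - y1) ^+ 2 + (o2 + ry * v2 + 1) ^+ 2 + (o3 + ry * v3) ^+ 2 <= 1 ->
  (o1 + rz * v1 - z1) ^+ 2 + (o2 + rz * v2 - 1) ^+ 2 + (o3 + rz * v3) ^+ 2 <= 1 ->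
  v2 = 0 /\ v3 = 0.
Proof.
move=> xy yz; move: (o1 + rx * v1 - x1) (o1 + ry * v1 - y1) (o1 + rz * v1 - z1) => X Y Z.
move=> hx hy hz; have X0 := sqr_ge0 X; have Y0 := sqr_ge0 Y; have Z0 := sqr_ge0 Z.
have A0 : 0 <= o2 + rx * v2 by have := sqr_ge0 (o3 + rx * v3); nra.
have B0 : o2 + ry * v2 <= 0 by have := sqr_ge0 (o3 + ry * v3); nra.
have C0 : 0 <= o2 + rz * v2 by have := sqr_ge0 (o3 + rz * v3); nra.
have v2xy : (ry - rx) * v2 <= 0 by lra.
have v2yz : 0 <= (rz - ry) * v2 by lra.
have v20 : v2 = 0.
  apply/eqP; rewrite eq_le; apply/andP; split.
    by move: v2xy; rewrite pmulr_rle0 // subr_gt0.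
  by move: v2yz; rewrite pmulr_rge0 // subr_gt0.
have o20 : o2 = 0 by move: A0 B0; rewrite v20; lra.
split=> //; move: hx hz; rewrite o20 v20 !mulr0 !addr0 !sub0r !sqrrN !expr1n => hx hz.
have zx0 : o3 + rx * v3 = 0.
  by apply/eqP; rewrite -sqrf_eq0; apply/eqP; have := sqr_ge0 (o3 + rx * v3); lra.
have zz0 : o3 + rz * v3 = 0.
  by apply/eqP; rewrite -sqrf_eq0; apply/eqP; have := sqr_ge0 (o3 + rz * v3); lra.
have : (rz - rx) * v3 = 0 by lra.
move/eqP; rewrite mulf_eq0 => /orP[/eqP rzx|/eqP //]; lra.
Qed.

(* In the frame [(u, n, m)] based at [o], the line [o + R u] is the first axis
   and the centers of the three balls are [(_, 1, 0)], [(_, -1, 0)], [(_, 1, 0)]. *)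
Definition frame o u x y z n m : Prop := [/\
  forall p q, dot p q = dot u p * dot u q + dot n p * dot n q + dot m p * dot m q,
  dot n (x - o) = 1 /\ dot m (x - o) = 0,
  dot n (y - o) = - 1 /\ dot m (y - o) = 0 &
  dot n (z - o) = 1 /\ dot m (z - o) = 0].

Lemma alternating_frame o u x y z n : dot u u = 1 -> dot n n = 1 -> dot u n = 0 ->
  off o u x = n -> off o u y = - n -> off o u z = n ->
  exists m, frame o u x y z n m.
Proof.
move=> uu nn un xE yE zE.
have [m [um nm parseval]] := orthonormal_frame _ _ uu nn un.
have offE p : p - o = off o u p + dot (p - o) u *: u by rewrite /off subrK.
exists m; split.
- by move=> p q; rewrite parseval !(dotC p) !(dotC q).
- by rewrite offE xE !dotDr !dotZr nn (dotC n u) un (dotC m u) um (dotC m n) nm !mulr0 !addr0.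
- by rewrite offE yE !dotDr !dotNr !dotZr nn (dotC n u) un
    (dotC m u) um (dotC m n) nm oppr0 !mulr0 !addr0.
- by rewrite offE zE !dotDr !dotZr nn (dotC n u) un (dotC m u) um (dotC m n) nm !mulr0 !addr0.
Qed.

Lemma frame_stabs o u x y z n m w : frame o u x y z n m -> stabs o u w ->
  dot n (w - o) ^+ 2 + dot m (w - o) ^+ 2 <= 1.
Proof. by move=> [parseval _ _ _]; rewrite /stabs (dotC _ u) parseval; lra. Qed.

Lemma dot_base o n p q : dot n (p - q) = dot n (p - o) - dot n (q - o).
Proof.
have -> : p - q = (p - o) - (q - o) by rewrite opprB addrA subrK.
by rewrite dotDr dotNr.
Qed.

Section OneFrame.
Variables (o u x y z n m w o' v : 'rV[R]_3).
Hypotheses (fr : frame o u x y z n m) (ow : stabs o u w) (vv : dot v v = 1).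

Let parseval p q : dot p q = dot u p * dot u q + dot n p * dot n q + dot m p * dot m q.
Proof. by have [] := fr. Qed.
Let nx : dot n (x - o) = 1. Proof. by have [_ []] := fr. Qed.
Let mx : dot m (x - o) = 0. Proof. by have [_ []] := fr. Qed.
Let ny : dot n (y - o) = - 1. Proof. by have [_ _ []] := fr. Qed.
Let my : dot m (y - o) = 0. Proof. by have [_ _ []] := fr. Qed.
Let nz : dot n (z - o) = 1. Proof. by have [_ _ _ []] := fr. Qed.
Let mz : dot m (z - o) = 0. Proof. by have [_ _ _ []] := fr. Qed.
Let ww : dot n (w - o) ^+ 2 + dot m (w - o) ^+ 2 <= 1.
Proof. exact: (frame_stabs _ _ _ _ _ _ _ _ fr ow). Qed.
Let vE : dot u v ^+ 2 + dot n v ^+ 2 + dot m v ^+ 2 = 1.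
Proof. by rewrite !expr2 -parseval. Qed.

Let baseE k := (dot_base o k w x, dot_base o k x w, dot_base o k w y, dot_base o k y w,
  dot_base o k w z, dot_base o k z w, dot_base o k y x, dot_base o k z x, dot_base o k x z,
  dot_base o k z y, dot_base o k y z).
Let frameE := (baseE n, baseE m, nx, mx, ny, my, nz, mz).

(* Orders on the two lines: [w x z] and [w z x]. *)
Lemma excl_first : 0 < dot u (x - w) -> 0 < dot u (z - x) ->
  4 <= dot (z - x) (z - x) -> stabs o' v z -> stabs o' v w ->
  0 < dot v (x - z) -> 0 < dot v (z - w) -> False.
Proof.
move=> wx xz sep sz sw vzx vwz; have stab := stabs_dist _ _ _ _ vv sw sz.
move: sep vzx vwz stab;
  rewrite !(parseval v) (parseval (z - x)) (parseval (z - w)) !frameE !(baseE u).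
move: wx xz; rewrite !(baseE u) => wx xz sep vzx vwz stab.
apply: (coord_excl_first _ (dot u (z - o) - dot u (x - o)) (dot u (z - o) - dot u (w - o))
  (1 - dot n (w - o)) (0 - dot m (w - o)) _ _ _ vE); try lra.
by apply: le_of_sqr_le; lra.
Qed.

(* Orders on the two lines: [x y w z] and [x z y]. *)
Lemma excl_mid : 0 < dot u (w - y) -> 0 < dot u (z - w) ->
  4 <= dot (w - y) (w - y) -> 4 <= dot (z - w) (z - w) ->
  stabs o' v y -> stabs o' v z ->
  0 < dot v (z - x) -> 0 < dot u (z - x) -> 0 < dot v (y - z) -> False.
Proof.
move=> yw wz sepyw sepwz sy sz vxz xz vzy; have stab := stabs_dist _ _ _ _ vv sz sy.
move: sepyw sepwz vxz vzy stab;
  rewrite !(parseval v) (parseval (w - y)) (parseval (z - w)) (parseval (y - z)) !frameE !(baseE u).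
move: yw wz xz; rewrite !(baseE u) => yw wz xz sepyw sepwz vxz vzy stab.
(* [x] and [z] agree transversally, so [dot v (z - x)] is [dot u v] times a positive length. *)
have uv : 0 < dot u v.
  move: vxz; rewrite (_ : _ + _ = dot u v * (dot u (z - o) - dot u (x - o))); last by ring.
  by rewrite pmulr_lgt0 //; lra.
apply: (coord_excl_mid _ (dot u (z - o) - dot u (y - o)) (dot u (w - o) - dot u (y - o))
  (dot n (w - o)) (dot m (w - o)) _ _ _ vE) => //; lra.
Qed.

(* Orders on the two lines: [x w y z] and [x z w]. *)
Lemma excl_between : 0 < dot u (w - x) -> 0 < dot u (y - w) -> 0 < dot u (z - y) ->
  4 <= dot (w - x) (w - x) -> 4 <= dot (y - w) (y - w) -> 4 <= dot (z - w) (z - w) ->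
  stabs o' v x -> stabs o' v z -> stabs o' v w ->
  0 < dot v (z - x) -> 0 < dot v (w - z) -> False.
Proof.
move=> xw wy yz sepxw sepwy sepwz sx sz sw vxz vzw.
have stabxz := stabs_dist _ _ _ _ vv sx sz; have stabzw := stabs_dist _ _ _ _ vv sz sw.
move: sepxw sepwy sepwz vxz vzw stabxz stabzw;
  rewrite !(parseval v) (parseval (w - x)) (parseval (y - w)) (parseval (z - w))
    (parseval (z - x)) (parseval (w - z))
    !frameE !(baseE u).
move: xw wy yz; rewrite !(baseE u) => xw wy yz sepxw sepwy sepwz vxz vzw stabxz stabzw.
have uv : 0 < dot u v.
  move: vxz; rewrite (_ : _ + _ = dot u v * (dot u (z - o) - dot u (x - o))); last by ring.
  by rewrite pmulr_lgt0 //; lra.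
apply: (coord_excl_between _ (dot u (y - o) - dot u (x - o)) (dot u (z - o) - dot u (y - o))
  (dot u (y - o) - dot u (w - o)) (dot n (w - o)) (dot m (w - o)) _ _ _ vE) => //; lra.
Qed.

(* Orders on the two lines: [x y z w] and [x z], [w y]. *)
Lemma excl_last : 0 < dot u (y - x) -> 0 < dot u (z - y) -> 0 < dot u (w - z) ->
  4 <= dot (z - x) (z - x) -> 4 <= dot (w - z) (w - z) -> 4 <= dot (w - y) (w - y) ->
  stabs o' v x -> stabs o' v w ->
  0 < dot v (z - x) -> 0 < dot v (y - w) -> False.
Proof.
move=> xy yz zw sepxz sepzw sepyw sx sw vxz vwy.
have stab := stabs_dist _ _ _ _ vv sx sw.
move: sepxz sepzw sepyw vxz vwy stab;
  rewrite !(parseval v) (parseval (z - x)) (parseval (w - z)) (parseval (w - y)) (parseval (w - x))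
    !frameE !(baseE u).
move: xy yz zw; rewrite !(baseE u) => xy yz zw sepxz sepzw sepyw vxz vwy stab.
have uv : 0 < dot u v.
  move: vxz; rewrite (_ : _ + _ = dot u v * (dot u (z - o) - dot u (x - o))); last by ring.
  by rewrite pmulr_lgt0 //; lra.
apply: (coord_excl_last _ (dot u (y - o) - dot u (x - o)) (dot u (z - o) - dot u (y - o))
  (dot u (w - o) - dot u (z - o)) (dot n (w - o)) (dot m (w - o)) _ _ _ vE) => //; try lra.
by apply: le_of_sqr_le; lra.
Qed.

(** By [alternating_foot_lines], applied to the feet of the centers on the second line, [v] is
    parallel to [u], with the same sense since both lines meet [x] before [z]. It is applied to a
    pair [p], [q] that the two lines order differently. *)
Lemma excl_same_order p q : 0 < dot u (z - x) ->
  stabs o' v x -> stabs o' v y -> stabs o' v z ->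
  0 < dot v (y - x) -> 0 < dot v (z - y) ->
  0 < dot u (q - p) -> 0 < dot v (q - p).
Proof.
move=> xz sx sy sz vxy vyz upq.
pose r c := dot v (c - o').
have foot c : stabs o' v c ->
    (dot u (o' - o) + r c * dot u v - dot u (c - o)) ^+ 2 +
    (dot n (o' - o) + r c * dot n v - dot n (c - o)) ^+ 2 +
    (dot m (o' - o) + r c * dot m v - dot m (c - o)) ^+ 2 <= 1.
  rewrite /stabs /r => sc; apply: le_trans sc.
  rewrite (dotC (c - o') v).
  have E k : dot k (o' - o) + dot v (c - o') * dot k v - dot k (c - o) =
      dot k (dot v (c - o') *: v - (c - o')).
    rewrite !dotDr !dotNr dotZr !dotDr !dotNr; ring.
  rewrite !E !expr2 -parseval; move: (c - o') => d.
  by rewrite !dotlin vv (dotC d v); lra.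
have rxy : r x < r y by rewrite -subr_gt0 /r -dot_base.
have ryz : r y < r z by rewrite -subr_gt0 /r -dot_base.
have := foot x sx; have := foot y sy; have := foot z sz.
rewrite nx mx ny my nz mz opprK !subr0 => hz hy hx.
have [nv mv] := alternating_foot_lines _ _ _ _ _ _ _ _ _ _ _ _ rxy ryz hx hy hz.
have vzx : 0 < dot v (z - x) by rewrite (dot_base o') -/(r z) -/(r x); lra.
move: vzx; rewrite !(parseval v) nv mv !mul0r !addr0 pmulr_lgt0 //.
by move=> uv; rewrite mulr_gt0.
Qed.

End OneFrame.

End Exclusions.

(** * Pinning by a proper subset of the four balls *)

Lemma pinned_frame (R : realType) (G : set (set 'rV[R]_3)) (l : line R)
    (o u x y z : 'rV[R]_3) :
  pins G l -> G `<=` [set unit_ball x; unit_ball y; unit_ball z] ->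
  l = line_through o u :> set _ -> dot u u = 1 ->
  0 < dot u (y - x) -> 0 < dot u (z - y) ->
  stabs o u x -> stabs o u y -> stabs o u z ->
  exists n m, frame o u x y z n m.
Proof.
move=> pin Gsub lE uu xy yz sx sy sz.
have [n [nn un xE yE zE]] :=
  pinned_alternating _ _ _ _ _ _ _ pin Gsub lE uu xy yz sx sy sz.
by exists n; exact: alternating_frame xE yE zE.
Qed.

Lemma sub_triple (T : Type) (G : set T) (x y z w t : T) :
  G `<=` [set x; y; z; w] -> ~ G t ->
  [/\ t = w -> G `<=` [set x; y; z], t = z -> G `<=` [set x; y; w],
    t = y -> G `<=` [set x; z; w] & t = x -> G `<=` [set y; z; w]].
Proof.
move=> GF Gt; split => tE X GX; have : X <> t by move=> Xt; apply: Gt; rewrite -Xt.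
all: by rewrite tE; have [[[]|]|] := GF X GX; rewrite /setU /=; tauto.
Qed.

Theorem theorem13 (R : realType) (a b c d : 'rV[R]_3) (sigma1 sigma2 : line R) :
  uniq [:: a; b; c; d] ->
  let F := [set unit_ball a; unit_ball b; unit_ball c; unit_ball d] in
  non_overlapping F ->
  pins F sigma1 -> realizes sigma1 [:: a; b; c; d] ->
  pins F sigma2 -> realizes sigma2 [:: a; c; d; b] ->
  forall G : set (set 'rV[R]_3), G `<` F ->
    ~ pins G sigma1 /\ ~ pins G sigma2.
Proof.
move=> abcd F Fno pin1 re1 pin2 re2 G [GF /existsNP[X /not_implyP[FX nGX]]].
have [ o1 [u [uu l1 /=]]] := realizes_unit _ _ re1.
rewrite !andbT => /and3P[/and3P[uab uac uad] /andP[ubc ubd] ucd].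
have [ o2 [v [vv l2 /=]]] := realizes_unit _ _ re2.
rewrite !andbT => /and3P[/and3P[vac vad vab] /andP[vcd vcb] vdb].
have [Fa Fb Fc Fd] : [/\ F (unit_ball a), F (unit_ball b), F (unit_ball c) & F (unit_ball d)].
  by split; rewrite /F /setU /=; tauto.
have s1 p : F (unit_ball p) -> stabs o1 u p.
  by move=> Fp; apply: meets_stabs uu _; rewrite -l1; have [/set_mem[+ _] _] := pin1; exact.
have s2 p : F (unit_ball p) -> stabs o2 v p.
  by move=> Fp; apply: meets_stabs vv _; rewrite -l2; have [/set_mem[+ _] _] := pin2; exact.
have far p q : F (unit_ball p) -> F (unit_ball q) -> p != q ->
    4 <= dot (p - q) (p - q) /\ 4 <= dot (q - p) (q - p).
  by move=> Fp Fq pq; split; apply: non_overlapping_dist Fno _ _ _; rewrite // eq_sym.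
move: abcd; rewrite /= !inE !negb_or !andbT.
move=> /and3P[/and3P[ab ac ad] /andP[bc bd] cd].
have [dab dba] := far a b Fa Fb ab; have [dac dca] := far a c Fa Fc ac.
have [dad dda] := far a d Fa Fd ad; have [dbc dcb] := far b c Fb Fc bc.
have [dbd ddb] := far b d Fb Fd bd; have [dcd ddc] := far c d Fc Fd cd.
have ltC (e p q : 'rV[R]_3) : 0 < dot e (q - p) -> 0 < dot e (p - q) -> False.
  by rewrite -(opprB p q) dotNr => qp pq; lra.
have [sa1 sb1 sc1 sd1] := And4 (s1 a Fa) (s1 b Fb) (s1 c Fc) (s1 d Fd).
have [sa2 sb2 sc2 sd2] := And4 (s2 a Fa) (s2 b Fb) (s2 c Fc) (s2 d Fd).
have [noD noC noB noA] := sub_triple _ _ _ _ _ _ _ GF nGX.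
have swap (x y z : set 'rV[R]_3) : [set x; y; z] `<=` [set x; z; y].
  by move=> Y; rewrite /setU /=; tauto.
have rot (x y z : set 'rV[R]_3) : [set x; y; z] `<=` [set y; z; x].
  by move=> Y; rewrite /setU /=; tauto.
have frame1 x y z := pinned_frame R G sigma1 o1 u x y z.
have frame2 x y z := pinned_frame R G sigma2 o2 v x y z.
case: FX => [[[XE|XE]|XE]|XE].
(* [a] comes first on both lines, and the outer balls of each triple are reversed on the other
   line. *)
- have Gsub := noA XE; split => pin.
    have [n [m fr]] := frame1 b c d pin Gsub l1 uu ubc ucd sb1 sc1 sd1.
    exact: (excl_first _ _ _ _ _ _ _ a o2 v fr vv).
  have [n [m fr]] := frame2 c d b pin (subset_trans Gsub (rot _ _ _)) l2 vv vcd vdb sc2 sd2 sb2.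
  exact: (excl_first _ _ _ _ _ _ _ a o1 u fr uu).
(* Both lines meet [a], [c], [d] in this order, yet they order [b] and [c] differently. *)
- have Gsub := noB XE; split => pin.
    have [n [m fr]] := frame1 a c d pin Gsub l1 uu uac ucd sa1 sc1 sd1.
    apply: (ltC v b c) => //.
    exact: (excl_same_order _ _ _ _ _ _ _ o2 v fr vv b c).
  have [n [m fr]] := frame2 a c d pin Gsub l2 vv vac vcd sa2 sc2 sd2.
  apply: (ltC u c b) => //.
  exact: (excl_same_order _ _ _ _ _ _ _ o1 u fr uu c b).
(* The orders compared are [a b c d] with [a d b], then [a c d b] with [a b c]. *)
- have Gsub := noC XE; split => pin.
    have [n [m fr]] := frame1 a b d pin Gsub l1 uu uab ubd sa1 sb1 sd1.
    exact: (excl_mid _ _ _ _ _ _ _ c o2 v fr _ vv).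
  have [n [m fr]] := frame2 a d b pin (subset_trans Gsub (swap _ _ _)) l2 vv vad vdb sa2 sd2 sb2.
  exact: (excl_between _ _ _ _ _ _ _ c o1 u fr _ uu).
(* The orders compared are [a b c d] with [a c] and [d b], then [a c d b] with [a b c]. *)
have Gsub := noD XE; split => pin.
  have [n [m fr]] := frame1 a b c pin Gsub l1 uu uab ubc sa1 sb1 sc1.
  exact: (excl_last _ _ _ _ _ _ _ d o2 v fr _ vv).
have [n [m fr]] := frame2 a c b pin (subset_trans Gsub (swap _ _ _)) l2 vv vac vcb sa2 sc2 sb2.
exact: (excl_mid _ _ _ _ _ _ _ d o1 u fr _ uu).
Qed.
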